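(* Let $\beta_1>\cdots>\beta_K>0$ and $\gamma_1>\cdots>\gamma_K>0$; let $f^e:(-\infty,0]\to\mathbb R$ be continuous and strictly decreasing with $f^e(0)=0$, and $f^l:[0,\infty)\to\mathbb R$ continuous and strictly increasing with $f^l(0)=0$. For $k\in\mathcal K=\{1,\dots,K\}$ let $$c_k(s)=\begin{cases}\beta_kf^e(s)& s\le0,\\ \gamma_kf^l(s)& s\ge0.\end{cases}$$ Let $\mu>0$, $Q_k>0$, $Q=\sum_{k}Q_k$, and consider $$\text{[2D-LP]}\quad\min_{\mathbf{x}\ge0}\ \sum_{k\in\mathcal K}\int_{\mathcal S}c_k(s)x_k(s)\,\mathrm{d}s\quad\text{s.t.}\quad\sum_{k\in\mathcal K}x_k(s)\le\mu\ \ \forall s\in\mathcal S,\qquad\int_{\mathcal S}x_k(s)\,\mathrm{d}s=Q_k\ \ \forall k\in\mathcal K.$$ Then: 1. The optimal solution $\mathbf{x}^*$ of [2D-LP] (the equilibrium flow pattern) is unique. 2. Let $X_k^e=\int_{\mathcal S\cap\{s\le0\}}x_k^*(s)\,\mathrm{d}s$, $X_k^l=\int_{\mathcal S\cap\{s>0\}}x_k^*(s)\,\mathrm{d}s$, $s_0^h=0$, $s_k^h=\sum_{k'\le k}X_{k'}^h/\mu$ for $h\in\{e,l\}$ and $k\in\mathcal K$, and $T^h=s^h_K$. Then $\mathbf{x}^*$ has the sorting property: all users in group $k$ depart from the bottleneck in the time intervals $[-s_k^e,-s_{k-1}^e]$ and $[s_{k-1}^l,s_k^l]$ (i.e. $x_k^*(s)=0$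 for almost every other $s\in\mathcal S$), and $$-T^e=-s_K^e\le\cdots\le-s_1^e\le0\le s_1^l\le\cdots\le s_K^l=T^l .$$ 3. If users in all groups depart from the bottleneck both early and late (i.e. all the inequalities in the chain displayed in part 2 are strict), then the equilibrium values of $s_k^e$ and $s_k^l$ are determined by the equations $$\begin{cases}s_k^l+s_k^e=\sum_{k'\le k}Q_{k'}/\mu,\\ \hat\beta_kf^e(-s_k^e)=\hat\gamma_kf^l(s_k^l)\quad(=v_k^*-v_{k+1}^* ),\end{cases}\qquad\forall k\in\mathcal K,$$ where $\hat\beta_k=\beta_k-\beta_{k+1}$, $\hat\gamma_k=\gamma_k-\gamma_{k+1}$, $\beta_{K+1}=\gamma_{K+1}=0$, $v_k^*$ is the equilibrium cost of group $k$, and $v_{K+1}^*=0$.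
   Context: $\mathcal S\subset\mathbb R$ is a given, sufficiently long time interval (containing $[-Q/\mu,Q/\mu]$ in its interior). The unknowns $x_k$ are nonnegative measurable functions on $\mathcal S$ (departure flow rates of group $k$ from a single bottleneck of capacity $\mu$); conditions on $s$ are understood for almost every $s$, and flows equal almost everywhere are identified. All users have the same preferred departure time $0$. A departure-time choice equilibrium is a triple $(\mathbf{x}^*,\mathbf{u}^*,\mathbf{v}^* )$ with $\mathbf{x}^*$ feasible for [2D-LP], $u^*(s)\ge0$, $v_k^*\in\mathbb R$, satisfying: $c_k(s)+u^*(s)-v^*_k\ge0$ with equality whenever $x^*_k(s)>0$; and $\sum_kx^*_k(s)=\mu$ whenever $u^*(s)>0$. Equivalently, $\mathbf{x}^*$ is optimal for [2D-LP] and $(\mathbf{u}^*,\mathbf{v}^* )$ is optimal for its dual $\max_{\mathbf u\ge0,\mathbf v}\,-\mu\int_{\mathcal S}u(s)\,\mathrm{d}s+\sum_kQ_kv_k$ subject to $c_k(s)+u(s)-v_k\ge0$ for all $k,s$. $v_k^*$ is the equilibrium cost of group $k$. *)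

(* Defs.v *)
From mathcomp Require Import all_boot all_order all_algebra.
From mathcomp Require Import all_classical all_reals all_analysis.
Import Order.TTheory GRing.Theory Num.Theory.
Import numFieldNormedType.Exports.

Set Implicit Arguments.
Unset Strict Implicit.
Unset Printing Implicit Defensive.

Local Open Scope classical_set_scope.
Local Open Scope ring_scope.

(* Groups are indexed from 0: the ordinal k : 'I_K stands for group k + 1. *)

Section Bottleneck.
Variables (R : realType) (K : nat).
Implicit Types (beta gamma Q v : 'I_K -> R) (fe fl u : R -> R).
Implicit Types (mu : R) (S : set R) (x : 'I_K -> R -> R).

Local Notation leb := (@lebesgue_measure R).

(* Only the values of [fe] on ]-oo, 0] and of [fl] on [0, +oo[ matter. *)
Definition cost beta gamma fe fl (k : 'I_K) (s : R) : R :=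
  if s <= 0 then beta k * fe s else gamma k * fl s.

Definition feasible mu Q S x : Prop :=
  [/\ forall k, measurable_fun S (x k),
      {ae leb, forall s, S s -> forall k, 0 <= x k s},
      {ae leb, forall s, S s -> \sum_(k < K) x k s <= mu}
    & forall k, (\int[leb]_(s in S) (x k s)%:E = (Q k)%:E)%E].

(* Possibly +oo, as [S] and the costs may be unbounded. *)
Definition total_cost (c : 'I_K -> R -> R) S x : \bar R :=
  (\sum_(k < K) \int[leb]_(s in S) (c k s * x k s)%:E)%E.

Definition optimal (c : 'I_K -> R -> R) mu Q S x : Prop :=
  feasible mu Q S x /\
  forall y, feasible mu Q S y -> (total_cost c S x <= total_cost c S y)%E.

Definition equilibrium (c : 'I_K -> R -> R) mu Q S x u v : Prop :=
  [/\ feasible mu Q S x,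
      measurable_fun S u,
      {ae leb, forall s, S s -> 0 <= u s},
      {ae leb, forall s, S s -> forall k, 0 <= c k s + u s - v k /\
                                  (0 < x k s -> c k s + u s - v k = 0)}
    & {ae leb, forall s, S s -> 0 < u s -> \sum_(k < K) x k s = mu}].

Definition early_amount S x (k : 'I_K) : R :=
  \int[leb]_(s in S `&` [set s | s <= 0]) x k s.

Definition late_amount S x (k : 'I_K) : R :=
  \int[leb]_(s in S `&` [set s | 0 < s]) x k s.

(* Cumulative over the first [n] groups, so 0 at n = 0 and T^h at n = K. *)
Definition s_early mu S x (n : nat) : R :=
  (\sum_(k < K | (k < n)%N) early_amount S x k) / mu.

Definition s_late mu S x (n : nat) : R :=
  (\sum_(k < K | (k < n)%N) late_amount S x k) / mu.

(* [drop_next a k] is a_k - a_{k+1}, where a_{K+1} = 0 in 1-based indexing. *)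
Definition drop_next (a : 'I_K -> R) (k : 'I_K) : R :=
  a k - oapp a 0 (insub k.+1).

End Bottleneck.

(* Main.v *)
Require Import Defs.
From mathcomp Require Import all_boot all_order all_algebra.
From mathcomp Require Import all_classical all_reals all_analysis.
From mathcomp Require Import measurable_realfun lra ring zify.
Import Order.TTheory GRing.Theory Num.Theory.
Import numFieldNormedType.Exports.

Set Implicit Arguments.
Unset Strict Implicit.
Unset Printing Implicit Defensive.

Local Open Scope classical_set_scope.
Local Open Scope ring_scope.

(* Let a_n and b_n be the lengths of the early and late windows used by the
   first n groups of a sorted pattern. Summation by parts turns its cost into a
   separable convex function of (a_n), minimized under 0 <= a_n - a_(n-1) <=
   Q_n / mu. The first-order conditions of this problem are solved by the
   intermediate value theorem, and they are exactly what is needed to price the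
   groups so that the sorted pattern becomes an equilibrium (u, v).

   Every equilibrium is optimal by weak duality; conversely equality in weak
   duality shows that every optimal pattern is an equilibrium with the same
   (u, v). As the c_j - c_k take each value at most once on each side of 0,
   almost every s has at most one group with zero slack, so that (u, v)
   determines the flows. Hence every optimal pattern is the sorted one. *)

(** * One-dimensional and sequential first-order conditions *)

(** Read [H] as the derivative of a convex function on [[a, a + q]]: [b] is a minimizer, either an
    endpoint or a zero of [H] given by the intermediate value theorem. The formula for [H b] does
    not mention [b], so the optimal derivative is visibly continuous and monotone in [a]. *)
Lemma ivt_complementarity (R : realType) (H : R -> R) (a q : R) :
    continuous H -> {homo H : x y / x <= y} -> 0 <= q ->
  exists b, [/\ a <= b <= a + q,
    H b = Num.max 0 (H a) + Num.min 0 (H (a + q)),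
    a < b -> H b <= 0 & b < a + q -> 0 <= H b].
Proof.
move=> Hc Hm q0; have aq : a <= a + q by rewrite lerDl.
have [Ha|Ha] := leP 0 (H a).
  exists a; split=> //; first by rewrite lexx.
    by rewrite (min_idPl _) ?addr0// (le_trans Ha)// Hm.
  by rewrite ltxx.
have [Hq|Hq] := leP (H (a + q)) 0.
  by exists (a + q); split=> //; rewrite ?aq ?lexx ?add0r ?ltxx.
have [||b] := @IVT R H a (a + q) 0 aq.
- exact: continuous_subspaceT.
- by rewrite ge_min le_max (ltW Ha) (ltW Hq) orbT.
rewrite in_itv/= => ab Hb; exists b.
by rewrite Hb addr0; split.
Qed.

(* [\sum_(i <= m < n) g m (a m.+1)] is the derivative in the i-th increment of
   the separable convex function with partial derivatives [g], so the path [a]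
   satisfies the first-order conditions of a box-constrained minimum. By
   backward induction [W] is the derivative of the value function, which makes
   the intermediate value theorem sufficient. *)
Lemma complementarity_path (R : realType) (n : nat) (g : nat -> R -> R)
    (q : nat -> R) :
    (forall i, continuous (g i)) -> (forall i, {homo g i : x y / x <= y}) ->
    (forall i, 0 <= q i) ->
  exists W : R -> R, [/\ continuous W, {homo W : x y / x <= y} & forall a0,
    exists a : nat -> R,
      [/\ a 0%N = a0, \sum_(0 <= m < n) g m (a m.+1) = W a0 &
        forall i, (i < n)%N ->
        [/\ a i <= a i.+1 <= a i + q i,
          a i < a i.+1 -> \sum_(i <= m < n) g m (a m.+1) <= 0 &
          a i.+1 < a i + q i -> 0 <= \sum_(i <= m < n) g m (a m.+1)]]].
Proof.
elim: n g q => [|n IHn] g q gc gm q0.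
  exists (fun=> 0); split=> // [x|a0]; first exact: cst_continuous.
  by exists (fun=> a0); split=> //; rewrite big_geq.
have [W' [W'c W'm W'P]] :=
  IHn (g \o S) (q \o S) (fun i => gc i.+1) (fun i => gm i.+1)
    (fun i => q0 i.+1).
(* Derivative in the first increment: its own term plus the derivative of the value function of the
   remaining steps. *)
pose H t := g 0%N t + W' t.
have Hc : continuous H by move=> x; apply: cvgD; [exact: gc|exact: W'c].
have Hm : {homo H : x y / x <= y} by move=> x y xy; rewrite lerD ?gm ?W'm.
exists (fun t => Num.max 0 (H t) + Num.min 0 (H (t + q 0%N))); split.
- move=> x; apply: cvgD.
    apply: (@continuous_max R R (cst 0) H); last exact: Hc.
    exact: cst_continuous.
  apply: (@continuous_min R R (cst 0) (fun t => H (t + q 0%N))).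
    exact: cst_continuous.
  apply: (@continuous_comp _ _ _ (fun t => t + q 0%N) H); last exact: Hc.
  by apply: cvgD; [exact: cvg_id|exact: cvg_cst].
- by move=> x y xy; rewrite lerD// ?le_max2 ?le_min2 ?Hm ?lerD.
move=> a0; have [a1 [a01 Ha1 Hle Hge]] := ivt_complementarity a0 Hc Hm (q0 0%N).
have [a [aa1 Da aP]] := W'P a1.
have D0 : \sum_(0 <= m < n.+1) g m (a m) = H a1.
  by rewrite big_nat_recl//= aa1 /H -Da.
exists (fun i => if i is j.+1 then a j else a0); split=> //=.
  by rewrite D0 Ha1.
case=> [_|i iln]; first by rewrite D0 aa1.
by rewrite big_add1; apply: aP.
Qed.

(** * Sorted patterns *)

Section Cells.
Variables (R : realType) (K : nat) (z : nat -> R).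
Hypothesis z_nd : forall i, (i < K)%N -> z i <= z i.+1.

Lemma cell_bounds_le i j : (i <= j)%N -> (j <= K)%N -> z i <= z j.
Proof.
move=> ij; rewrite -(subnKC ij); elim: (j - i)%N => [|d IH] dK.
  by rewrite addn0.
by rewrite (le_trans (IH _))// ?addnS ?z_nd//; lia.
Qed.

(** Consecutive cells tile the whole interval, empty cells counting for nothing. The left-closed
    version serves the early side, where [s] is replaced by [- s]. *)
Lemma sum_left_closed_cells (t : R) :
  \sum_(k < K) ((z k <= t < z k.+1)%R%:R : R) = (z 0%N <= t < z K)%R%:R.
Proof.
have := leqnn K; elim: {-2}K => [|n IHn] nK.
  by rewrite big_ord0; case: leP => //= z0t; rewrite ltNge z0t.
rewrite big_ord_recr/= IHn 1?ltnW//.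
have := z_nd nK; have := @cell_bounds_le 0 n isT (ltnW nK).
case: (leP (z 0%N) t); case: (ltP t (z n)); case: (ltP t (z n.+1)) => //=;
  by rewrite ?addr0 ?add0r// => *; exfalso; lra.
Qed.

Lemma sum_right_closed_cells (t : R) :
  \sum_(k < K) ((z k < t <= z k.+1)%R%:R : R) = (z 0%N < t <= z K)%R%:R.
Proof.
have := leqnn K; elim: {-2}K => [|n IHn] nK.
  by rewrite big_ord0; case: ltP => //= z0t; rewrite leNgt z0t.
rewrite big_ord_recr/= IHn 1?ltnW//.
have := z_nd nK; have := @cell_bounds_le 0 n isT (ltnW nK).
case: (ltP (z 0%N) t); case: (leP t (z n)); case: (leP t (z n.+1)) => //=;
  by rewrite ?addr0 ?add0r// => *; exfalso; lra.
Qed.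

End Cells.

Lemma sum_recenter (R : realType) (n k : nat) (h y : nat -> R) (p : R) :
  \sum_(k <= m < n) h m * y m =
  (\sum_(k <= m < n) h m) * p + \sum_(k <= m < n) h m * (y m - p).
Proof.
by rewrite mulr_suml -big_split/=; apply: eq_bigr => m _; ring.
Qed.

(* Dual feasibility of the prices [p k = \sum_(k <= m < n) h m * phi (z m.+1)]
   for the rents [\sum_m h m * max 0 (phi (z m.+1) - phi t)], and complementary
   slackness on the k-th cell. *)
Lemma price_le_rent (R : realType) (n : nat) (h z : nat -> R) (phi : R -> R)
    (k : nat) (t : R) : (k <= n)%N -> (forall m, 0 <= h m) ->
  \sum_(k <= m < n) h m * phi (z m.+1) <=
  (\sum_(k <= m < n) h m) * phi t +
  \sum_(0 <= m < n) h m * Num.max 0 (phi (z m.+1) - phi t).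
Proof.
move=> kn h0; rewrite (sum_recenter _ _ _ _ (phi t)) lerD2l.
rewrite [leRHS](@big_cat_nat _ _ _ k)//=.
rewrite -[leLHS]add0r lerD//; last first.
  by apply: ler_sum => m _; rewrite ler_wpM2l// le_max lexx orbT.
by apply: sumr_ge0 => m _; rewrite mulr_ge0// le_max lexx.
Qed.

Lemma price_eq_rent (R : realType) (n : nat) (h z : nat -> R) (phi : R -> R)
    (k : nat) (t : R) : (k < n)%N -> {homo phi : x y / x <= y} ->
    (forall i, (i < n)%N -> z i <= z i.+1) -> z k <= t <= z k.+1 ->
  \sum_(k <= m < n) h m * phi (z m.+1) =
  (\sum_(k <= m < n) h m) * phi t +
  \sum_(0 <= m < n) h m * Num.max 0 (phi (z m.+1) - phi t).
Proof.
move=> kn phim zm /andP[kt tk].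
rewrite (sum_recenter _ _ _ _ (phi t)); congr (_ + _).
rewrite [RHS](@big_cat_nat _ _ _ k) ?(ltnW kn)//=.
(* Below index [k] every [z m.+1] is at most [t], so the positive part vanishes; from [k] on it is
   at least [t], so the positive part is the difference itself. *)
rewrite [X in _ = X + _](_ : _ = 0) ?add0r; last first.
  rewrite big_nat big1// => m /andP[_ mk].
  rewrite (max_idPl _) ?mulr0// subr_le0 phim//.
  by rewrite (le_trans _ kt)// (cell_bounds_le zm)// ltnW.
rewrite big_nat [RHS]big_nat; apply: eq_bigr => m /andP[km mn].
by rewrite (max_idPr _)// subr_ge0 phim// (le_trans tk)// (cell_bounds_le zm)//.
Qed.

(** * Measure-theoretic preliminaries *)

(** The difference is nonnegative almost everywhere and its integral is at most 0; finiteness is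
    what allows the integrals to be subtracted. This yields the equality case of weak duality. *)
Lemma ae_eq_le_integral d (T : measurableType d) (R : realType)
    (m : {measure set T -> \bar R}) (D : set T) (f g : T -> R) :
    measurable D -> measurable_fun D f -> measurable_fun D g ->
    (forall x, 0 <= f x) -> (forall x, 0 <= g x) ->
    {ae m, forall x, D x -> g x <= f x} ->
    (\int[m]_(x in D) (g x)%:E < +oo)%E ->
    (\int[m]_(x in D) (f x)%:E <= \int[m]_(x in D) (g x)%:E)%E ->
  {ae m, forall x, D x -> f x = g x}.
Proof.
move=> mD mf mg f0 g0 gf goo fg.
have intble (h : T -> R) : measurable_fun D h -> (forall x, 0 <= h x) ->
    (\int[m]_(x in D) (h x)%:E < +oo)%E -> m.-integrable D (EFin \o h).
  move=> mh h0 hoo; apply/integrableP; split; first exact/measurable_EFinP.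
  rewrite (eq_integral (fun x => (h x)%:E))// => x _.
  by rewrite /= ger0_norm.
have ig := intble _ mg g0 goo.
have jf := intble _ mf f0 (le_lt_trans fg goo).
have mfg : measurable_fun D (fun x => ((f x)%:E - (g x)%:E)%E).
  by apply: emeasurable_funB; exact/measurable_EFinP.
have h0 : (\int[m]_(x in D) `|(f x)%:E - (g x)%:E| = 0)%E.
  apply/eqP; rewrite eq_le; apply/andP; split; last exact: integral_ge0.
  rewrite (ae_eq_integral (fun x => ((f x)%:E - (g x)%:E)%E))//.
  - rewrite (integralB mD jf ig) sube_le0.
      exact: fg.
  - by apply: measurableT_comp.
  - apply: filterS gf => x gfx Dx; rewrite gee0_abs// sube_ge0//.
    by rewrite lee_fin gfx.
have /(ae_eq_integral_abs _ mD mfg) := h0.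
apply: filterS => x fgx Dx; apply/eqP; rewrite -subr_eq0.
by have := fgx Dx => /= -[->].
Qed.

Lemma measurable_EFin_fun d (T : measurableType d) (R : realType) (D : set T)
  (f : T -> R) : measurable_fun D f -> measurable_fun D (fun x => (f x)%:E).
Proof. by move=> mf; apply/measurable_EFinP. Qed.

(* Not found by type class resolution, as [R] is not syntactically a measurable
   type. *)
#[local] Instance ae_lebesgue_filter (R : realType) :
  Filter (almost_everywhere (@lebesgue_measure R)).
Proof. exact: ae_filter_ringOfSetsType. Qed.

(** * Weak duality *)

Section Duality.
Variables (R : realType) (K : nat).
Local Notation leb := (@lebesgue_measure R).

(** Weak duality is read as a comparison of this integrand with the one where [x] and [y] are
    swapped. The integral of the rent is thus never formed, and the truncations keep nonnegative
    costs and prices summing to a nonnegative integrand at every [s], so infinite costs are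
    harmless. *)
Definition lagrangian (c : 'I_K -> R -> R) (v : 'I_K -> R)
    (x y : 'I_K -> R -> R) (s : R) : R :=
  \sum_(k < K) (c k s * Num.max 0 (x k s) + v k * Num.max 0 (y k s)).

(** Complementary slackness of [x] lets [c k * x k] be traded for [(v k - u) * x k] and [u * mu] for
    the rent paid by [x]. The gap that remains is the total slack of [y]. *)
Lemma slackness_identity (c v x y : 'I_K -> R) (u mu : R) :
    (forall k, (c k + u - v k) * x k = 0) -> u * (mu - \sum_(k < K) x k) = 0 ->
  \sum_(k < K) (c k * y k + v k * x k) =
  \sum_(k < K) (c k * x k + v k * y k) +
  (\sum_(k < K) (c k + u - v k) * y k + u * (mu - \sum_(k < K) y k)).
Proof.
move=> cx ux.
have {}ux : u * mu = \sum_(k < K) u * x k.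
  by apply/eqP; rewrite -mulr_sumr -subr_eq0 -mulrBr ux.
rewrite mulrBr ux mulr_sumr -sumrN -!big_split/=; apply: eq_bigr => k _.
by have := cx k; lra.
Qed.

Variables (c : 'I_K -> R -> R) (mu : R) (Q : 'I_K -> R) (S : set R).
Hypotheses (mS : measurable S) (mc : forall k, measurable_fun S (c k)).
Hypotheses (c_ge0 : forall k s, 0 <= c k s) (Q_gt0 : forall k, 0 < Q k).
Implicit Types (x y : 'I_K -> R -> R) (u : R -> R) (v : 'I_K -> R).

Lemma feasible_measurable_max x k : feasible mu Q S x ->
  measurable_fun S (fun s => Num.max 0 (x k s)).
Proof.
case=> mx _ _ _.
by apply: (@measurable_maxr _ _ _ _ (cst 0) (x k)) => //; exact: measurable_cst.
Qed.

Lemma feasible_integral_max x k : feasible mu Q S x ->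
  (\int[leb]_(s in S) (Num.max 0 (x k s))%:E = (Q k)%:E)%E.
Proof.
move=> fx; have [mx x0 _ <-] := fx; apply: ae_eq_integral => //.
- by apply: measurable_EFin_fun; exact: feasible_measurable_max.
- by apply: measurable_EFin_fun; exact: mx.
- by apply: filterS x0 => s x0 Ss; rewrite (max_idPr (x0 Ss k)).
Qed.

Lemma lagrangian_ge0 v x y s : (forall k, 0 <= v k) ->
  0 <= lagrangian c v x y s.
Proof.
move=> v0; apply: sumr_ge0 => k _.
by rewrite addr_ge0// mulr_ge0// le_max lexx.
Qed.

Lemma measurable_lagrangian v x y : feasible mu Q S x -> feasible mu Q S y ->
  measurable_fun S (lagrangian c v x y).
Proof.
move=> fx fy; apply: measurable_sum => k; apply: measurable_funD.
  apply: measurable_funM; [exact: mc|exact: feasible_measurable_max].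
apply: measurable_funM; [exact: measurable_cst|].
exact: feasible_measurable_max.
Qed.

(** The price terms integrate to the same finite constant for every feasible [y], and truncation
    changes the flows only on a null set. *)
Lemma total_cost_lagrangian v x y : (forall k, 0 <= v k) ->
    feasible mu Q S x -> feasible mu Q S y ->
  (total_cost c S x + (\sum_(k < K) v k * Q k)%:E =
   \int[leb]_(s in S) (lagrangian c v x y s)%:E)%E.
Proof.
move=> v0 fx fy; have [mx x0 _ _] := fx.
have mcx k : measurable_fun S (fun s => (c k s * Num.max 0 (x k s))%:E).
  apply: measurable_EFin_fun; apply: measurable_funM;
    [exact: mc|exact: feasible_measurable_max].
have mvy k : measurable_fun S (fun s => (v k * Num.max 0 (y k s))%:E).
  apply: measurable_EFin_fun; apply: measurable_funM;
    [exact: measurable_cst|exact: feasible_measurable_max].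
have cx0 k s : (0 <= (c k s * Num.max 0 (x k s))%:E)%E.
  by rewrite lee_fin mulr_ge0// le_max lexx.
have vy0 k s : (0 <= (v k * Num.max 0 (y k s))%:E)%E.
  by rewrite lee_fin mulr_ge0// le_max lexx.
rewrite /total_cost -sumEFin -big_split/=.
under [RHS]eq_integral => s _ do rewrite /lagrangian -sumEFin.
rewrite ge0_integral_sum//; first last.
- by move=> k s _; rewrite EFinD adde_ge0.
- move=> k; under eq_fun do rewrite EFinD.
  exact: (emeasurable_funD (mcx k) (mvy k)).
apply: eq_bigr => k _; under [RHS]eq_integral => s _ do rewrite EFinD.
rewrite ge0_integralD//; [congr (_ + _)%E|exact: mcx|exact: mvy].
  apply: ae_eq_integral => //.
  - apply: measurable_EFin_fun.
    by apply: measurable_funM; [exact: mc|exact: mx].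
  - exact: mcx.
  by apply: filterS x0 => s x0 Ss; rewrite (max_idPr (x0 Ss k)).
under eq_integral => s _ do rewrite EFinM.
rewrite ge0_integralZl_EFin//.
- by rewrite feasible_integral_max// EFinM.
- by move=> s _; rewrite lee_fin le_max lexx.
- by apply: measurable_EFin_fun; exact: feasible_measurable_max.
Qed.

(** With a negative price the slack of group [k] would be positive almost everywhere, so the group
    would have no flow, against [0 < Q k]. *)
Lemma equilibrium_price_ge0 x u v k : equilibrium c mu Q S x u v -> 0 <= v k.
Proof.
move=> [[mx x0 _ xQ] _ u0 cuv _]; rewrite leNgt; apply/negP => vk.
have : (\int[leb]_(s in S) (x k s)%:E = \int[leb]_(s in S) 0)%E.
  apply: ae_eq_integral => //.
    by apply: measurable_EFin_fun; exact: mx.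
  apply: filterS (filterI x0 (filterI u0 cuv)) => s [x0s [u0s cuvs]] Ss.
  congr (_%:E); apply/eqP; rewrite eq_le x0s// andbT leNgt; apply/negP.
  move=> /((cuvs Ss k).2); apply/eqP; rewrite gt_eqF//.
  by rewrite subr_gt0 (lt_le_trans vk)// addr_ge0// u0s.
by rewrite xQ integral0 => -[] /eqP; rewrite gt_eqF.
Qed.

(** By [slackness_identity] the gap is a sum of nonnegative products. If it is zero each product
    vanishes, which is complementary slackness of [y] with the same multipliers. *)
Lemma equilibrium_lagrangian_le x u v y :
    equilibrium c mu Q S x u v -> feasible mu Q S y ->
  {ae leb, forall s, S s ->
    lagrangian c v x y s <= lagrangian c v y x s /\
    (lagrangian c v y x s = lagrangian c v x y s ->
     (forall k, 0 < y k s -> c k s + u s - v k = 0) /\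
     (0 < u s -> \sum_(k < K) y k s = mu))}.
Proof.
move=> [[mx x0 xmu xQ] mu_ u0 cuv umu] [my y0 ymu yQ].
apply: filterS (filterI (filterI x0 (filterI xmu u0))
  (filterI (filterI cuv umu) (filterI y0 ymu))).
move=> s [[+ [+ +]] [[+ +] [+ +]]] Ss.
move=> /(_ Ss) x0s /(_ Ss) xmus /(_ Ss) u0s /(_ Ss) cuvs /(_ Ss) umus.
move=> /(_ Ss) y0s /(_ Ss) ymus; rewrite /lagrangian.
have max_nonneg (a b : 'I_K -> R -> R) (w z : 'I_K -> R) :
    (forall k, 0 <= a k s) -> (forall k, 0 <= b k s) ->
    \sum_(k < K) (w k * Num.max 0 (a k s) + z k * Num.max 0 (b k s)) =
    \sum_(k < K) (w k * a k s + z k * b k s).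
  by move=> a0 b0; apply: eq_bigr => k _; rewrite !(max_idPr _).
rewrite !max_nonneg//.
rewrite (@slackness_identity (c^~ s) v (x^~ s) (y^~ s) (u s) mu)/=; first last.
- have [us|us] := ltP 0 (u s); first by rewrite umus// subrr mulr0.
  by rewrite (_ : u s = 0) ?mul0r//; apply/eqP; rewrite eq_le us u0s.
- move=> k; have [xk|xk] := ltP 0 (x k s); first by rewrite (cuvs k).2// mul0r.
  by rewrite (_ : x k s = 0) ?mulr0//; apply/eqP; rewrite eq_le xk x0s.
have sy0 k : 0 <= (c k s + u s - v k) * y k s.
  by rewrite mulr_ge0// (cuvs k).1.
have uy0 : 0 <= u s * (mu - \sum_(k < K) y k s).
  by rewrite mulr_ge0// subr_ge0.
have sumy0 : 0 <= \sum_(k < K) (c k s + u s - v k) * y k s by exact: sumr_ge0.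
split; first by rewrite lerDl addr_ge0.
move=> /eqP; rewrite -subr_eq0 addrAC subrr add0r paddr_eq0//.
rewrite psumr_eq0// => /andP[/allP sy /eqP uy]; split.
  move=> k yk; have /= := sy k; rewrite mem_index_enum => /(_ isT).
  by rewrite mulf_eq0 (gt_eqF yk) orbF => /eqP.
move=> us; apply/eqP; rewrite eq_sym -subr_eq0.
by move/eqP: uy; rewrite mulf_eq0 (gt_eqF us).
Qed.

Lemma equilibrium_optimal x u v :
  equilibrium c mu Q S x u v -> optimal c mu Q S x.
Proof.
move=> eq_x; have [fx _ _ _ _] := eq_x; split=> // y fy.
have v0 k : 0 <= v k by exact: equilibrium_price_ge0 eq_x.
(* The added constant is finite, hence cancellable even if a total cost is infinite. *)
rewrite -(@leeD2rE _ (\sum_(k < K) v k * Q k)%:E)//.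
rewrite (total_cost_lagrangian v0 fx fy) (total_cost_lagrangian v0 fy fx).
apply: ae_ge0_le_integral => //.
- by move=> s _; rewrite lee_fin lagrangian_ge0.
- by apply: measurable_EFin_fun; exact: measurable_lagrangian.
- by move=> s _; rewrite lee_fin lagrangian_ge0.
- by apply: measurable_EFin_fun; exact: measurable_lagrangian.
apply: filterS (equilibrium_lagrangian_le eq_x fy) => s + Ss.
by move=> /(_ Ss)[+ _]; rewrite lee_fin.
Qed.

End Duality.

(** * Equality in weak duality and uniqueness of the flows *)

Section SharedMultipliers.
Variables (R : realType) (K : nat).
Local Notation leb := (@lebesgue_measure R).
Variables (c : 'I_K -> R -> R) (mu : R) (Q : 'I_K -> R) (S : set R).
Hypotheses (mS : measurable S) (mc : forall k, measurable_fun S (c k)).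
Hypotheses (c_ge0 : forall k s, 0 <= c k s) (Q_gt0 : forall k, 0 < Q k).
Implicit Types (x y : 'I_K -> R -> R) (u : R -> R) (v : 'I_K -> R).

(** Where group [k] departs, zero slack and a nonnegative rent bound its cost by [v k]. Replacing
    costs by these constants leaves an integral determined by the demands. *)
Lemma equilibrium_lagrangian_fin x u v y :
    equilibrium c mu Q S x u v -> feasible mu Q S y ->
  (\int[leb]_(s in S) (lagrangian c v x y s)%:E < +oo)%E.
Proof.
move=> eq_x fy; have [fx _ u0 cuv _] := eq_x.
have v0 k : 0 <= v k by exact: (equilibrium_price_ge0 mS c_ge0 Q_gt0 k eq_x).
have mv k : measurable_fun S (cst (v k) : R -> R) by exact: measurable_cst.
apply: (@le_lt_trans _ _
  (\int[leb]_(s in S) (lagrangian (fun k => cst (v k)) v x y s)%:E)%E).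
  apply: ae_ge0_le_integral => //.
  - by move=> s _; rewrite lee_fin lagrangian_ge0.
  - apply: measurable_EFin_fun.
    exact: (measurable_lagrangian mc v fx fy).
  - move=> s _; rewrite lee_fin.
    by apply: lagrangian_ge0 => // k ?; exact: v0.
  - apply: measurable_EFin_fun.
    exact: (measurable_lagrangian mv v fx fy).
  apply: filterS (filterI u0 cuv) => s [u0s cuvs] Ss.
  rewrite lee_fin; apply: ler_sum => k _; rewrite lerD2r.
  have [xk|xk] := ltP 0 (x k s); last first.
    by rewrite !mulr0.
  have := (cuvs Ss k).2 xk; have := u0s Ss => u0' ckE.
  by rewrite ler_wpM2r ?(ltW xk)//=; lra.
rewrite -(total_cost_lagrangian mS mv (fun k _ => v0 k) v0 fx fy)//=.
rewrite lte_add_pinfty ?ltry//.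
rewrite /total_cost; apply/lte_sum_pinfty => k _.
have [mx x0 _ _] := fx.
have mvx : measurable_fun S (fun s => ((v k)%:E * (Num.max 0 (x k s))%:E)%E).
  under eq_fun do rewrite -EFinM.
  apply: measurable_EFin_fun; apply: measurable_funM; first exact: mv.
  exact: (feasible_measurable_max k fx).
suff -> : (\int[leb]_(s in S) (cst (v k) s * x k s)%:E = (v k)%:E * (Q k)%:E)%E.
  by rewrite -EFinM ltry.
rewrite -(feasible_integral_max mS k fx) -ge0_integralZl_EFin//; first last.
- by apply: measurable_EFin_fun; exact: (feasible_measurable_max k fx).
- by move=> s _; rewrite lee_fin le_max lexx.
apply: ae_eq_integral => //.
  apply: measurable_EFin_fun; apply: measurable_funM; first exact: mv.
  exact: (mx k).
by apply: filterS x0 => s x0 Ss; rewrite -EFinM (max_idPr (x0 Ss k)).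
Qed.

(** Optimality of [y] reverses the integrated inequality, so the two integrands agree almost
    everywhere and the equality case transfers the slackness conditions to [y]. The other conditions
    on [u] and [v] do not involve the flow. *)
Lemma optimal_equilibrium x u v y :
    equilibrium c mu Q S x u v -> optimal c mu Q S y ->
  equilibrium c mu Q S y u v.
Proof.
move=> eq_x [fy ymin]; have [fx mu_ u0 cuv _] := eq_x.
have v0 k : 0 <= v k by exact: (equilibrium_price_ge0 mS c_ge0 Q_gt0 k eq_x).
have lag_le := equilibrium_lagrangian_le eq_x fy.
have lag_eq : {ae leb, forall s, S s ->
    lagrangian c v y x s = lagrangian c v x y s}.
  apply: (@ae_eq_le_integral _ _ R leb S _ _ mS).
  - exact: (measurable_lagrangian mc v fy fx).
  - exact: (measurable_lagrangian mc v fx fy).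
  - by move=> s; exact: lagrangian_ge0.
  - by move=> s; exact: lagrangian_ge0.
  - by apply: filterS lag_le => s + Ss => /(_ Ss)[].
  - exact: equilibrium_lagrangian_fin eq_x fy.
  - rewrite -(total_cost_lagrangian mS mc c_ge0 v0 fy fx).
    rewrite -(total_cost_lagrangian mS mc c_ge0 v0 fx fy).
    by rewrite leeD2rE// ymin.
split=> //.
  apply: filterS (filterI cuv (filterI lag_le lag_eq)).
  move=> s [cuvs [les eqs]] Ss k; split; first exact: (cuvs Ss k).1.
  exact: ((les Ss).2 (eqs Ss)).1.
apply: filterS (filterI lag_le lag_eq) => s [les eqs] Ss.
exact: ((les Ss).2 (eqs Ss)).2.
Qed.

(* For almost every [s] at most one group has zero slack, and where the rent
   vanishes none has. *)
Lemma equilibrium_flow_unique x y u v :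
    {ae leb, forall s, S s -> forall k : 'I_K, c k s != v k} ->
    {ae leb, forall s, S s -> forall j k : 'I_K, j != k ->
      c j s - c k s != v j - v k} ->
    equilibrium c mu Q S x u v -> equilibrium c mu Q S y u v ->
  {ae leb, forall s, S s -> forall k, x k s = y k s}.
Proof.
move=> cv cvd [[_ x0 _ _] _ u0 cuvx umux] [[_ y0 _ _] _ _ cuvy umuy].
apply: filterS (filterI (filterI cv (filterI cvd u0))
  (filterI (filterI cuvx umux) (filterI (filterI cuvy umuy) (filterI x0 y0)))).
move=> s [[+ [+ +]] [[+ +] [[+ +] [+ +]]]] Ss.
move=> /(_ Ss) cvs /(_ Ss) cvds /(_ Ss) u0s /(_ Ss) cuvxs /(_ Ss) umuxs.
move=> /(_ Ss) cuvys /(_ Ss) umuys /(_ Ss) x0s /(_ Ss) y0s.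
have zero (z : 'I_K -> R -> R) k : (forall k, 0 <= z k s) ->
    (forall k, 0 <= c k s + u s - v k /\
               (0 < z k s -> c k s + u s - v k = 0)) ->
    c k s + u s - v k != 0 -> z k s = 0.
  move=> z0 zs ck; apply/eqP; rewrite eq_le z0 andbT leNgt.
  by apply: contra ck => /((zs k).2) ->.
have [/existsP[k /eqP kE]|nk] :=
    boolP [exists k, c k s + u s - v k == 0]; last first.
  move=> k; move: nk; rewrite negb_exists => /forallP/(_ k) ck.
  by rewrite (zero x)// (zero y).
have slack j : j != k -> c j s + u s - v j != 0.
  move=> jk; apply: contra (cvds _ _ jk) => /eqP jE.
  by apply/eqP; move: kE jE; lra.
(* With zero rent, the zero slack of [k] would read [c k s = v k], which [cvs] excludes. Hence
   capacity binds and both flows give all of it to [k]. *)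
have us : 0 < u s.
  rewrite lt_neqAle u0s andbT eq_sym; apply: contra (cvs k) => /eqP uE.
  by move: kE; rewrite uE addr0 => /eqP; rewrite subr_eq0.
have single (z : 'I_K -> R -> R) : (forall k, 0 <= z k s) ->
    (forall k, 0 <= c k s + u s - v k /\
               (0 < z k s -> c k s + u s - v k = 0)) ->
    \sum_(k < K) z k s = mu -> z k s = mu.
  move=> z0 zs <-; rewrite (bigD1 k)//= big1 ?addr0// => j jk.
  by rewrite (zero z)// slack.
move=> j; have [->|jk] := eqVneq j k.
  by rewrite (single x x0s cuvxs (umuxs us)) (single y y0s cuvys (umuys us)).
by rewrite (zero x)// ?(zero y)// slack.
Qed.

End SharedMultipliers.

(** * Group parameters extended by zero *)

Section NatExtension.
Variables (R : realType) (K : nat).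
Implicit Types a : 'I_K -> R.

(** The padding encodes the convention that the parameters of group [K + 1] vanish, so recursions
    can run over plain integers. *)
Definition ext0 a (n : nat) : R := oapp a 0 (insub n).

Lemma ext0_ord a (k : 'I_K) : ext0 a k = a k.
Proof. by rewrite /ext0 valK. Qed.

Lemma ext0_ge a n : (K <= n)%N -> ext0 a n = 0.
Proof. by move=> Kn; rewrite /ext0 insubF//; apply/negbTE; rewrite -leqNgt. Qed.

Definition decr a (n : nat) : R := ext0 a n - ext0 a n.+1.

Lemma drop_nextE a (k : 'I_K) : drop_next a k = decr a k.
Proof. by rewrite /decr ext0_ord. Qed.

(** The sum telescopes down to the zero padding. It is the summation by parts that splits a group's
    coefficient into drops. *)
Lemma sum_decr a k : (k <= K)%N -> \sum_(k <= m < K) decr a m = ext0 a k.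
Proof.
move=> kK; rewrite (eq_bigr (fun m => - ext0 a m.+1 - - ext0 a m)); last first.
  by move=> m _; rewrite opprK addrC.
rewrite (telescope_sumr (fun m => - ext0 a m) kK).
by rewrite ext0_ge// oppr0 opprK add0r.
Qed.

End NatExtension.

Lemma decr_gt0 (R : realType) (K : nat) (a : 'I_K -> R) (n : nat) :
    (forall k, 0 < a k) -> (forall i j : 'I_K, (i < j)%N -> a j < a i) ->
  (n < K)%N -> 0 < decr a n.
Proof.
move=> a0 adecr nK; rewrite /decr (ext0_ord a (Ordinal nK)) subr_gt0.
(* At the last index the drop is the last coefficient itself, positive by [a0]. *)
have [nK1|Kn] := ltnP n.+1 K; last by rewrite ext0_ge.
by rewrite (ext0_ord a (Ordinal nK1)); apply: adecr => /=.
Qed.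

Lemma decr_ge0 (R : realType) (K : nat) (a : 'I_K -> R) (n : nat) :
    (forall k, 0 < a k) -> (forall i j : 'I_K, (i < j)%N -> a j < a i) ->
  0 <= decr a n.
Proof.
move=> a0 adecr; have [nK|Kn] := ltnP n K; first exact/ltW/decr_gt0.
by rewrite /decr !ext0_ge ?subrr// ltnW.
Qed.

(** * The sorted equilibrium *)

Section SortedFlow.
Variables (R : realType) (K : nat) (mu : R) (a b : nat -> R).
Local Notation leb := (@lebesgue_measure R).

(** All cells are right-closed, so that they tile []- a K, b K]] without overlap and 0 is never
    counted on both sides. *)
Definition sorted_flow (k : 'I_K) (s : R) : R :=
  mu * (\1_(`]- a k.+1, - a k]%classic) s + \1_(`]b k, b k.+1]%classic) s).

Hypotheses (mu_gt0 : 0 < mu) (a0 : a 0%N = 0) (b0 : b 0%N = 0).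
Hypothesis a_nd : forall i, (i < K)%N -> a i <= a i.+1.
Hypothesis b_nd : forall i, (i < K)%N -> b i <= b i.+1.

Lemma sorted_flow_early k s :
  s <= 0 -> sorted_flow k s = mu * (a k <= - s < a k.+1)%R%:R.
Proof.
move=> s0; rewrite /sorted_flow !indicE !mem_setE !in_itv/=.
have -> : (b k < s)%R = false.
  apply/negbTE; rewrite -leNgt (le_trans s0)// -b0.
  by rewrite (cell_bounds_le b_nd)// ltnW.
by rewrite /= addr0 andbC lerNr ltrNl.
Qed.

Lemma sorted_flow_late k s :
  0 < s -> sorted_flow k s = mu * (b k < s <= b k.+1)%R%:R.
Proof.
move=> s0; rewrite /sorted_flow !indicE !mem_setE !in_itv/=.
have -> : (s <= - a k)%R = false.
  apply/negbTE; rewrite -ltNge (le_lt_trans _ s0)// oppr_le0.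
  by rewrite -[leLHS]a0 (cell_bounds_le a_nd)// ltnW.
by rewrite andbF add0r.
Qed.

Lemma sorted_flow_ge0 k s : 0 <= sorted_flow k s.
Proof. by rewrite /sorted_flow mulr_ge0 ?(ltW mu_gt0)// addr_ge0. Qed.

Lemma sum_sorted_flow s :
  \sum_(k < K) sorted_flow k s = mu * (- a K < s <= b K)%R%:R.
Proof.
have aK : 0 <= a K by rewrite -[leLHS]a0 (cell_bounds_le a_nd).
have bK : 0 <= b K by rewrite -[leLHS]b0 (cell_bounds_le b_nd).
have [s0|s0] := leP s 0.
  under eq_bigr => k _ do rewrite sorted_flow_early//.
  rewrite -mulr_sumr sum_left_closed_cells// a0 oppr_ge0 s0/=.
  by rewrite (le_trans s0 bK) andbT ltrNl.
under eq_bigr => k _ do rewrite sorted_flow_late//.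
rewrite -mulr_sumr sum_right_closed_cells// b0 s0/=.
by rewrite (le_lt_trans _ s0)// oppr_le0.
Qed.

Lemma measurable_sorted_flow (S : set R) k : measurable_fun S (sorted_flow k).
Proof.
apply: measurable_funM; first exact: measurable_cst.
by apply: measurable_funD; exact: measurable_indic.
Qed.

Lemma integral_itv_indic (S : set R) (p r : R) : measurable S -> p <= r ->
    `]p, r] `<=` S ->
  (\int[leb]_(s in S) (\1_(`]p, r]%classic) s)%:E = (r - p)%:E)%E.
Proof.
move=> mS pr prS; have len : leb `]p, r]%classic = (r - p)%:E.
  rewrite lebesgue_measure_itv/= lte_fin; case: ltP => // rp.
  by rewrite (_ : r = p) ?subrr//; apply/eqP; rewrite eq_le rp.
by rewrite integral_indic// (setIidl prS).
Qed.

Lemma integral_sorted_flow (S : set R) (k : 'I_K) : measurable S ->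
    `[- a K, b K] `<=` S ->
  (\int[leb]_(s in S) (sorted_flow k s)%:E =
   (mu * ((a k.+1 - a k) + (b k.+1 - b k)))%:E)%E.
Proof.
move=> mS abS; under eq_integral => s _ do rewrite /sorted_flow EFinM EFinD.
rewrite ge0_integralZl_EFin ?(ltW mu_gt0)//; first last.
- apply: emeasurable_funD; apply: measurable_EFin_fun; exact: measurable_indic.
- by move=> s _; rewrite adde_ge0// lee_fin.
have aK i : (i <= K)%N -> 0 <= a i <= a K.
  by move=> iK; rewrite -[X in X <= _]a0 !(cell_bounds_le a_nd).
have bK i : (i <= K)%N -> 0 <= b i <= b K.
  by move=> iK; rewrite -[X in X <= _]b0 !(cell_bounds_le b_nd).
have := (aK _ (ltn_ord k), aK _ (ltnW (ltn_ord k))).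
have := (bK _ (ltn_ord k), bK _ (ltnW (ltn_ord k))).
move=> [bk1 bk] [ak1 ak].
rewrite ge0_integralD//; first last.
- by apply: measurable_EFin_fun; exact: measurable_indic.
- by apply: measurable_EFin_fun; exact: measurable_indic.
rewrite !integral_itv_indic//.
- by rewrite -EFinD -EFinM; congr (_%:E); lra.
- by rewrite b_nd.
- move=> s /=; rewrite in_itv/= => /andP[? ?].
  by apply: abS; rewrite /= in_itv/=; lra.
- by rewrite lerN2 a_nd.
- move=> s /=; rewrite in_itv/= => /andP[? ?].
  by apply: abS; rewrite /= in_itv/=; lra.
Qed.

Lemma integral_scaled_indic (D : set R) (p r : R) : measurable D -> p <= r ->
    `]p, r] `<=` D ->
  \int[leb]_(s in D) (mu * \1_(`]p, r]%classic) s) = mu * (r - p).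
Proof.
move=> mD pr prD; rewrite /Rintegral; under eq_integral do rewrite EFinM.
rewrite ge0_integralZl_EFin ?(ltW mu_gt0)//; first last.
  by apply: measurable_EFin_fun; exact: measurable_indic.
by rewrite integral_itv_indic.
Qed.

Lemma early_amount_sorted_flow (S : set R) (k : 'I_K) : measurable S ->
  `[- a K, b K] `<=` S -> early_amount S sorted_flow k = mu * (a k.+1 - a k).
Proof.
move=> mS abS; rewrite /early_amount.
have mS0 : measurable (S `&` [set s | s <= 0]).
  by apply: measurableI => //; rewrite -set_itvNyc; exact: measurable_itv.
have ak : 0 <= a k by rewrite -[leLHS]a0 (cell_bounds_le a_nd)// ltnW.
have akK : a k.+1 <= a K by rewrite (cell_bounds_le a_nd).
have bK : 0 <= b K by rewrite -[leLHS]b0 (cell_bounds_le b_nd).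
transitivity (\int[leb]_(s in S `&` [set s | s <= 0])
    (mu * \1_(`]- a k.+1, - a k]%classic) s)).
  apply: eq_Rintegral => s; rewrite inE => -[_ /= s0].
  rewrite sorted_flow_early// indicE mem_setE in_itv/=.
  by rewrite andbC lerNr ltrNl.
rewrite integral_scaled_indic ?lerN2 ?a_nd//.
  by rewrite opprK addrC.
move=> s /=; rewrite in_itv/= => /andP[? ?]; split; last lra.
by apply: abS; rewrite /= in_itv/=; lra.
Qed.

Lemma late_amount_sorted_flow (S : set R) (k : 'I_K) : measurable S ->
  `[- a K, b K] `<=` S -> late_amount S sorted_flow k = mu * (b k.+1 - b k).
Proof.
move=> mS abS; rewrite /late_amount.
have mS0 : measurable (S `&` [set s | 0 < s]).
  by apply: measurableI => //; rewrite -set_itvoy; exact: measurable_itv.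
have bk : 0 <= b k by rewrite -[leLHS]b0 (cell_bounds_le b_nd)// ltnW.
have bkK : b k.+1 <= b K by rewrite (cell_bounds_le b_nd).
have aK : 0 <= a K by rewrite -[leLHS]a0 (cell_bounds_le a_nd).
transitivity (\int[leb]_(s in S `&` [set s | 0 < s])
    (mu * \1_(`]b k, b k.+1]%classic) s)).
  apply: eq_Rintegral => s; rewrite inE => -[_ /= s0].
  by rewrite sorted_flow_late// indicE mem_setE in_itv.
rewrite integral_scaled_indic ?b_nd//.
move=> s /=; rewrite in_itv/= => /andP[? ?]; split; last lra.
by apply: abS; rewrite /= in_itv/=; lra.
Qed.

End SortedFlow.

(** * Continuity on half-lines and null level sets *)

(** Meant for a clamp [g]: a function continuous only on a half-line becomes continuous on the whole
    line. *)
Lemma continuous_comp_within (R : realType) (A : set R) (f g : R -> R) :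
    {within A, continuous f} -> continuous g -> (forall t, A (g t)) ->
  continuous (fun t => f (g t)).
Proof.
move=> /subspace_continuousP fA gc gA t P /(fA _ (gA t)) fP.
have gP : nbhs t (fun y => A (g y) -> P (f (g y))) := gc t _ fP.
exact: filterS (fun y Py => Py (gA y)) gP.
Qed.

Lemma ae_neq_cst (R : realType) (p : R) :
  {ae @lebesgue_measure R, forall s, s != p}.
Proof.
exists [set p]; split => //; first exact: lebesgue_measure_set1.
by move=> s /= /negP; rewrite negbK => /eqP.
Qed.

(** The level set is at most a singleton. *)
Lemma ae_neq_injective (R : realType) (D : set R) (f : R -> R) (r : R) :
    (forall s t, D s -> D t -> f s = f t -> s = t) ->
  {ae @lebesgue_measure R, forall s, D s -> f s != r}.
Proof.
move=> finj; have [[p Dp fp]|np] := pselect (exists2 p, D p & f p = r).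
  apply: filterS (ae_neq_cst p) => s sp Ds; apply: contra sp => /eqP fs.
  by apply/eqP; apply: finj => //; rewrite fs.
by apply: filterE => s Ds; apply/eqP => fs; apply: np; exists s.
Qed.

(* A conull subset of [`]p, r[] accumulates at both endpoints. *)
Lemma ae_le_itv_cvg (R : realType) (h : R -> R) (p r q C : R) :
    continuous h -> p < r -> p <= q <= r ->
    {ae @lebesgue_measure R, forall s, p < s < r -> h s <= C} ->
  h q <= C.
Proof.
move=> hc pr /andP[pq qr] [N [mN N0 hN]]; rewrite leNgt; apply/negP => Chq.
have : \forall s \near q, C < h s.
  exact: (cvgr_gt (h q) (hc q) _ Chq).
move=> [e /= e0 he].
(* Cutting []p, r[] with the ball around [q] leaves a nondegenerate interval even when [q] is an
   endpoint. It lies in the null set [N], which contradicts its positive length. *)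
pose l := Num.max p (q - e); pose m := Num.min r (q + e).
have lm : l < m by rewrite lt_min !gt_max; lra.
have sub : `]l, m[%classic `<=` N.
  move=> s /=; rewrite in_itv/= /l /m gt_max lt_min.
  move=> /andP[/andP[? ?] /andP[? ?]].
  apply: hN => /= hs.
  have : C < h s by apply: he; rewrite /= ltr_distlC; lra.
  by rewrite ltNge hs//; lra.
have : (@lebesgue_measure R `]l, m[%classic <= @lebesgue_measure R N)%E.
  by apply: le_measure; rewrite ?inE//; exact: measurable_itv.
rewrite N0 lebesgue_measure_itv/= lte_fin lm -EFinD lee_fin; lra.
Qed.

(** * Costs, prices and rents of sorted patterns *)

Section PeakCost.
Variables (R : realType) (K : nat) (beta gamma : 'I_K -> R).
Variables (phie phil : R -> R).
Local Notation leb := (@lebesgue_measure R).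
(** Both [phie] and [phil] measure the distance from the preferred time 0, so the two sides can
    share the lemmas on nondecreasing functions. *)
Local Notation c := (cost beta gamma (fun s => phie (- s)) phil).
Hypotheses (phie_cont : continuous phie) (phil_cont : continuous phil).
Hypotheses (phie_nd : {homo phie : s t / s <= t}).
Hypotheses (phil_nd : {homo phil : s t / s <= t}).
Hypotheses (phie0 : phie 0 = 0) (phil0 : phil 0 = 0).

Lemma measurable_fun_early_late (S : set R) (f g : R -> R) :
    measurable_fun [set: R] f -> measurable_fun [set: R] g -> measurable S ->
  measurable_fun S (fun s => if s <= 0 then f s else g s).
Proof.
move=> mf mg mS; apply: (@measurable_funS _ _ _ _ setT) => //.
apply: measurable_fun_ifT => //.
by apply: measurable_fun_ler; [exact: measurable_id|exact: measurable_cst].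
Qed.

Lemma measurable_phie_opp : measurable_fun [set: R] (fun s => phie (- s)).
Proof.
apply: continuous_measurable_fun => s.
by apply: (@continuous_comp _ _ _ (fun s => - s) phie);
  [exact: opp_continuous|exact: phie_cont].
Qed.

Lemma measurable_cost (S : set R) k : measurable S -> measurable_fun S (c k).
Proof.
apply: measurable_fun_early_late.
  by apply: measurable_funM; [exact: measurable_cst|exact: measurable_phie_opp].
apply: measurable_funM; first exact: measurable_cst.
exact: continuous_measurable_fun.
Qed.

Section Injectivity.
Hypotheses (phie_lt : forall s t, 0 <= s -> s < t -> phie s < phie t).
Hypotheses (phil_lt : forall s t, 0 <= s -> s < t -> phil s < phil t).

(** Coefficients are only required to be nonzero, so that the result also covers a difference of two
    costs, whose coefficients may have any sign. *)
Lemma cost_ae_neq (k : 'I_K) (r : R) : beta k != 0 -> gamma k != 0 ->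
  {ae leb, forall s, c k s != r}.
Proof.
move=> bk gk.
have phi_inj (phi : R -> R) s t :
    (forall s t, 0 <= s -> s < t -> phi s < phi t) -> 0 <= s -> 0 <= t ->
    phi s = phi t -> s = t.
  move=> phi_lt s0 t0 st; apply/eqP; rewrite eq_le !leNgt.
  by apply/andP; split; apply/negP => /phi_lt;
    rewrite st ltxx => /(_ _)/negP; exact.
have early : {ae leb, forall s, s <= 0 -> beta k * phie (- s) != r}.
  apply: ae_neq_injective => s t s0 t0 /(mulfI bk) /phi_inj st.
  by apply: oppr_inj; apply: st; rewrite ?oppr_ge0.
have late : {ae leb, forall s, 0 <= s -> gamma k * phil s != r}.
  by apply: ae_neq_injective => s t s0 t0 /(mulfI gk) /phi_inj; exact.
apply: filterS (filterI early late) => s [es ls]; rewrite /cost.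
by case: ifPn => [/es//|]; rewrite -ltNge => /ltW/ls.
Qed.

End Injectivity.

Section SortedEquilibrium.
Hypothesis beta_gt0 : forall k, 0 < beta k.
Hypothesis gamma_gt0 : forall k, 0 < gamma k.
Hypothesis beta_decr : forall i j : 'I_K, (i < j)%N -> beta j < beta i.
Hypothesis gamma_decr : forall i j : 'I_K, (i < j)%N -> gamma j < gamma i.

Lemma cost_ge0 k s : 0 <= c k s.
Proof.
rewrite /cost; have [s0|s0] := leP s 0.
  by rewrite mulr_ge0 ?(ltW (beta_gt0 k))// -[leLHS]phie0 phie_nd// oppr_ge0.
by rewrite mulr_ge0 ?(ltW (gamma_gt0 k))// -[leLHS]phil0 phil_nd// ltW.
Qed.

(** On the cell of a group this is its price minus its cost, by [price_eq_rent]; the positive parts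
    discard the groups whose cells end nearer to 0. *)
Definition sorted_rent (a b : nat -> R) (s : R) : R :=
  if s <= 0 then
    \sum_(0 <= m < K) decr beta m * Num.max 0 (phie (a m.+1) - phie (- s))
  else \sum_(0 <= m < K) decr gamma m * Num.max 0 (phil (b m.+1) - phil s).

(** Solves the recursion in which consecutive prices differ by the difference of the two groups'
    costs at the end [a n.+1] of cell [n], starting from price 0 after the last group. *)
Definition early_price (a : nat -> R) (n : nat) : R :=
  \sum_(n <= m < K) decr beta m * phie (a m.+1).

Definition late_price (b : nat -> R) (n : nat) : R :=
  \sum_(n <= m < K) decr gamma m * phil (b m.+1).

Lemma early_price_recl a n : (n < K)%N ->
  early_price a n = decr beta n * phie (a n.+1) + early_price a n.+1.
Proof. by move=> nK; rewrite /early_price big_ltn. Qed.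

Lemma late_price_recl b n : (n < K)%N ->
  late_price b n = decr gamma n * phil (b n.+1) + late_price b n.+1.
Proof. by move=> nK; rewrite /late_price big_ltn. Qed.

Lemma rent_gt0_lt (n : nat) (h z : nat -> R) (phi : R -> R) (t : R) :
    {homo phi : x y / x <= y} -> (forall i, (i < n)%N -> z i <= z i.+1) ->
    0 < \sum_(0 <= m < n) h m * Num.max 0 (phi (z m.+1) - phi t) ->
  t < z n.
Proof.
move=> phi_nd z_nd; rewrite [t < _]ltNge; apply: contraTN => znt.
rewrite -leNgt big_nat big1// => m /andP[_ mn].
rewrite (max_idPl _) ?mulr0// subr_le0 phi_nd//.
by rewrite (le_trans _ znt)// (cell_bounds_le z_nd).
Qed.

(** A single price must serve both sides: staying below both candidate prices gives nonnegative
    slack, and equality is needed only on the sides where the group has a nonempty cell. *)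
Lemma sorted_equilibrium (mu : R) (Q : 'I_K -> R) (S : set R) (a b : nat -> R)
    (v : 'I_K -> R) :
    0 < mu -> measurable S -> `[- a K, b K] `<=` S -> a 0%N = 0 -> b 0%N = 0 ->
    (forall i, (i < K)%N -> a i <= a i.+1) ->
    (forall i, (i < K)%N -> b i <= b i.+1) ->
    (forall k : 'I_K, mu * ((a k.+1 - a k) + (b k.+1 - b k)) = Q k) ->
    (forall k : 'I_K, v k <= early_price a k /\ v k <= late_price b k) ->
    (forall k : 'I_K, a k < a k.+1 -> v k = early_price a k) ->
    (forall k : 'I_K, b k < b k.+1 -> v k = late_price b k) ->
  equilibrium c mu Q S (sorted_flow mu a b) (sorted_rent a b) v.
Proof.
move=> mu0 mS abS a0 b0 a_nd b_nd abQ v_le v_early v_late; split.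
- split.
  + by move=> k; exact: measurable_sorted_flow.
  + by apply: filterE => s _ k; exact: sorted_flow_ge0.
  + apply: filterE => s _; rewrite sum_sorted_flow//.
    by case: (_ && _); rewrite ?mulr1 ?mulr0 ?(ltW mu0).
  + by move=> k; rewrite integral_sorted_flow// abQ.
- apply: measurable_fun_early_late => //.
    apply: measurable_sum => m.
    apply: measurable_funM; first exact: measurable_cst.
    apply: (@measurable_maxr _ _ _ _ (cst 0)); first exact: measurable_cst.
    apply: measurable_funB; first exact: measurable_cst.
    exact: measurable_phie_opp.
  apply: measurable_sum => m.
  apply: measurable_funM; first exact: measurable_cst.
  apply: (@measurable_maxr _ _ _ _ (cst 0)); first exact: measurable_cst.
  apply: measurable_funB; first exact: measurable_cst.
  exact: continuous_measurable_fun.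
- apply: filterE => s _; rewrite /sorted_rent; case: ifP => _.
    apply: sumr_ge0 => m _; rewrite mulr_ge0 ?decr_ge0//.
    by rewrite le_max lexx.
  apply: sumr_ge0 => m _; rewrite mulr_ge0 ?decr_ge0//.
  by rewrite le_max lexx.
- apply: filterE => s _ k.
  have kK := ltn_ord k; have [vke vkl] := v_le k.
  rewrite /cost /sorted_rent; have [s0|s0] := leP s 0.
    (* Writing the coefficient as a sum of drops brings the slack into the form of [price_le_rent]
       and [price_eq_rent]. *)
    have -> : beta k = \sum_(k <= m < K) decr beta m.
      by rewrite sum_decr ?ext0_ord// ltnW.
    split.
      rewrite subr_ge0 (le_trans vke)// /early_price.
      apply: (@price_le_rent _ K (decr beta) a phie k (- s)); first exact: ltnW.
      by move=> m; exact: (decr_ge0 m beta_gt0 beta_decr).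
    rewrite sorted_flow_early//; case: (boolP (_ && _)) => [/andP[ak ka] _|_].
      rewrite v_early ?(le_lt_trans ak ka)// /early_price.
      rewrite (@price_eq_rent _ K (decr beta) a phie k (- s))// ?subrr//.
      by rewrite ak ltW.
    by rewrite mulr0 ltxx.
  have -> : gamma k = \sum_(k <= m < K) decr gamma m.
    by rewrite sum_decr ?ext0_ord// ltnW.
  split.
    rewrite subr_ge0 (le_trans vkl)// /late_price.
    apply: (@price_le_rent _ K (decr gamma) b phil k s); first exact: ltnW.
    by move=> m; exact: (decr_ge0 m gamma_gt0 gamma_decr).
  rewrite sorted_flow_late//; case: (boolP (_ && _)) => [/andP[bk kb] _|_].
    rewrite v_late ?(lt_le_trans bk kb)// /late_price.
    rewrite (@price_eq_rent _ K (decr gamma) b phil k s)// ?subrr//.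
    by rewrite kb ltW.
  by rewrite mulr0 ltxx.
- apply: filterE => s _; rewrite /sorted_rent sum_sorted_flow//.
  have aK : 0 <= a K by rewrite -[leLHS]a0 (cell_bounds_le a_nd).
  have bK : 0 <= b K by rewrite -[leLHS]b0 (cell_bounds_le b_nd).
  (* A positive rent places [s] strictly inside the window of its side, where the cells fill the
     capacity. *)
  have [s0|s0] := leP s 0 => u_gt0.
    have sa := @rent_gt0_lt K (decr beta) a phie (- s) phie_nd a_nd u_gt0.
    by rewrite ltrNl sa (le_trans s0 bK) mulr1.
  have sb := @rent_gt0_lt K (decr gamma) b phil s phil_nd b_nd u_gt0.
  by rewrite (ltW sb) (le_lt_trans _ s0) ?mulr1// oppr_le0.
Qed.

End SortedEquilibrium.

End PeakCost.

(** * Cumulative amounts and demands *)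

Lemma sum_increments (R : realType) (K : nat) (z : nat -> R) (n : nat) :
  (n <= K)%N -> \sum_(k < K | (k < n)%N) (z k.+1 - z k) = z n - z 0%N.
Proof.
move=> nK; rewrite -(big_ord_widen K (fun k => z k.+1 - z k) nK).
by rewrite -(big_mkord xpredT (fun k => z k.+1 - z k)) telescope_sumr.
Qed.

Lemma cumulative_amount (R : realType) (K : nat) (mu : R) (X : 'I_K -> R)
    (z : nat -> R) (n : nat) :
    mu != 0 -> z 0%N = 0 -> (forall k : 'I_K, X k = mu * (z k.+1 - z k)) ->
  (n <= K)%N -> (\sum_(k < K | (k < n)%N) X k) / mu = z n.
Proof.
move=> mu0 z0 XE nK; under eq_bigr => k _ do rewrite XE.
by rewrite -mulr_sumr sum_increments// z0 subr0 mulrC mulKf.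
Qed.

Lemma sum_ord_ext0 (R : realType) (K : nat) (Q : 'I_K -> R) (n : nat) :
  \sum_(k < K | (k < n)%N) Q k = \sum_(0 <= m < n) ext0 Q m.
Proof.
have [nK|Kn] := leqP n K.
  rewrite big_mkord (big_ord_widen K (ext0 Q) nK).
  by apply: eq_bigr => k _; rewrite ext0_ord.
rewrite (@big_cat_nat _ _ _ K) ?(ltnW Kn)//= [X in _ + X]big_nat.
rewrite [X in _ + X]big1 ?addr0; last first.
  by move=> m /andP[Km _]; rewrite ext0_ge.
rewrite big_mkord; apply: eq_big => [k|k _]; last by rewrite ext0_ord.
by rewrite (ltn_trans (ltn_ord k)).
Qed.

(** * Existence of the sorted bounds and the equilibrium price drops *)

Section PeakEquilibrium.
Variables (R : realType) (K : nat) (beta gamma : 'I_K -> R).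
Variables (phie phil : R -> R).
Local Notation leb := (@lebesgue_measure R).
Local Notation c := (cost beta gamma (fun s => phie (- s)) phil).
Hypotheses (phie_cont : continuous phie) (phil_cont : continuous phil).
Hypotheses (phie_nd : {homo phie : s t / s <= t}).
Hypotheses (phil_nd : {homo phil : s t / s <= t}).

(** The demands fix [a n + b n], so only the path [a] is free. The first-order conditions along it
    compare the early and late prices of each group. *)
Lemma sorted_bounds_exist (mu : R) (Q : 'I_K -> R) :
    (forall k, 0 < beta k) -> (forall k, 0 < gamma k) ->
    (forall i j : 'I_K, (i < j)%N -> beta j < beta i) ->
    (forall i j : 'I_K, (i < j)%N -> gamma j < gamma i) ->
    0 < mu -> (forall k, 0 < Q k) ->
  exists a b : nat -> R,
    [/\ a 0%N = 0, b 0%N = 0,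
      (forall n, a n + b n = (\sum_(k < K | (k < n)%N) Q k) / mu) &
      forall i, (i < K)%N ->
      [/\ a i <= a i.+1, b i <= b i.+1,
        a i < a i.+1 ->
          early_price beta phie a i <= late_price gamma phil b i &
        b i < b i.+1 ->
          late_price gamma phil b i <= early_price beta phie a i]].
Proof.
move=> beta0 gamma0 betaD gammaD mu0 Q0.
pose L n := (\sum_(k < K | (k < n)%N) Q k) / mu.
pose q n := ext0 Q n / mu.
have LS n : L n.+1 = L n + q n.
  by rewrite /L /q !sum_ord_ext0 big_nat_recr//= mulrDl.
have q0 n : 0 <= q n.
  rewrite /q mulr_ge0 ?invr_ge0 ?(ltW mu0)//.
  by rewrite /ext0; case: insub => //= k; exact: ltW.
(* Marginal cost of moving the [n]-th bound towards the early side while the total length [L n.+1]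
   stays fixed. *)
pose g n t := decr beta n * phie t - decr gamma n * phil (L n.+1 - t).
have gc n : continuous (g n).
  move=> t; apply: cvgB; (apply: cvgM; first exact: cvg_cst).
    exact: phie_cont.
  apply: (@continuous_comp _ _ _ (fun t => L n.+1 - t) phil);
    last exact: phil_cont.
  by apply: cvgB; [exact: cvg_cst|exact: cvg_id].
have g_nd n : {homo g n : s t / s <= t}.
  move=> s t st; rewrite /g lerB// ler_wpM2l ?decr_ge0 ?phie_nd ?phil_nd//.
  by rewrite lerB.
have [W [_ _ /(_ 0)[a [a0 _ aP]]]] := @complementarity_path R K g q gc g_nd q0.
exists a, (fun n => L n - a n).
have D i : \sum_(i <= m < K) g m (a m.+1) =
    early_price beta phie a i - late_price gamma phil (fun n => L n - a n) i.
  by rewrite /early_price /late_price -sumrB.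
split=> //.
- by rewrite /L a0 big1 ?mul0r ?subr0// => k; rewrite ltn0.
- by move=> n; rewrite addrC subrK.
move=> i iK; have [/andP[a_nd a_q] Dle Dge] := aP _ iK.
split=> //.
- by rewrite LS; lra.
- by move=> /Dle; rewrite D subr_le0.
(* The late cell is nonempty exactly when the early increment stays below its upper bound [q i]. *)
- move=> b_lt; rewrite -subr_ge0 -D; apply: Dge.
  by move: b_lt; rewrite LS; lra.
Qed.

(** On the early cell of group [k] its slack is zero and that of the next group is nonnegative; on
    the next cell the roles are exchanged. The two inequalities between cost and price differences
    meet at [- a k.+1] by continuity. For the last group, the time just before the window takes the
    place of the next cell. *)
Lemma equilibrium_price_drop (mu : R) (Q : 'I_K -> R) (S : set R)
    (a b : nat -> R) (u : R -> R) (v : 'I_K -> R) (k : 'I_K) :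
    0 < mu -> `[- a K, b K] `<=` interior S -> a 0%N = 0 -> b 0%N = 0 ->
    (forall i, (i < K)%N -> a i < a i.+1) ->
    (forall i, (i < K)%N -> b i <= b i.+1) ->
    equilibrium c mu Q S (sorted_flow mu a b) u v ->
  decr beta k * phie (a k.+1) = decr v k.
Proof.
move=> mu0 abS a0 b0 a_lt b_nd [_ _ u0 cuv umu].
have a_nd i : (i < K)%N -> a i <= a i.+1 by move=> /a_lt/ltW.
have bK : 0 <= b K by rewrite -[leLHS]b0 (cell_bounds_le b_nd).
have aE i : (i <= K)%N -> 0 <= a i <= a K.
  by move=> iK; rewrite -[X in X <= _]a0 !(cell_bounds_le a_nd).
have inS s : - a K <= s <= 0 -> S s.
  move=> sa; apply: interior_subset; apply: abS => /=.
  by rewrite in_itv/=; lra.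
pose h s := decr beta k * phie (- s).
have hc : continuous h.
  move=> s; apply: cvgM; first exact: cvg_cst.
  by apply: (@continuous_comp _ _ _ (fun s => - s) phie);
    [exact: opp_continuous|exact: phie_cont].
have hE s : s <= 0 -> h s = c k s - ext0 beta k.+1 * phie (- s).
  by move=> s0; rewrite /h /decr ext0_ord /cost s0 mulrBl.
have kK := ltn_ord k.
have ak := aE _ (ltnW kK); have ak1 := aE _ kK; have akk := a_lt _ kK.
have above : {ae leb, forall s, - a k.+1 < s < - a k -> h s <= decr v k}.
  apply: filterS (filterI u0 cuv) => s [us cs] /andP[ks sk].
  have s0 : s <= 0 by lra.
  have Ss : S s by apply: inS; lra.
  have vk : c k s + u s - v k = 0.
    apply: (cs Ss k).2; rewrite sorted_flow_early//.
    by rewrite (_ : _ && _ = true) ?mulr1//; lra.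
  rewrite hE// /decr ext0_ord; have := us Ss.
  have [k1K|Kk1] := ltnP k.+1 K; last first.
    by rewrite !ext0_ge// mul0r; move: vk; lra.
  have := (cs Ss (Ordinal k1K)).1.
  rewrite -/(nat_of_ord (Ordinal k1K)) !(ext0_ord _ (Ordinal k1K)).
  by rewrite {1}/cost s0; move: vk; lra.
have [p pa below] : exists2 p, p < - a k.+1 &
    {ae leb, forall s, p < s < - a k.+1 -> - h s <= - decr v k}.
  have [k1K|Kk1] := ltnP k.+1 K.
    exists (- a k.+2); first by have := a_lt _ k1K; lra.
    have ak2 := aE _ k1K.
    apply: filterS cuv => s cs /andP[ks sk].
    have s0 : s <= 0 by lra.
    have Ss : S s by apply: inS; lra.
    have vk : c (Ordinal k1K) s + u s - v (Ordinal k1K) = 0.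
      apply: (cs Ss _).2; rewrite sorted_flow_early//=.
      by rewrite (_ : _ && _ = true) ?mulr1//; lra.
    rewrite hE// /decr ext0_ord; have := (cs Ss k).1.
    rewrite !(ext0_ord _ (Ordinal k1K)).
    by move: vk; rewrite {1}/cost s0; lra.
  (* Just before [- a K] the time is still in [S], by the interior hypothesis, but no group departs
     there. The rent is therefore zero, and nonnegative slack bounds the last price by the cost. *)
  have KE : k.+1 = K by apply/eqP; rewrite eqn_leq kK Kk1.
  have [e /= e0 eS] : nbhs (- a K) S.
    by apply: abS; rewrite /= in_itv/= lexx; move: (aE K (leqnn K)); lra.
  exists (- a k.+1 - e); first lra.
  apply: filterS (filterI u0 (filterI cuv umu)).
  move=> s [us [cs us_mu]] /andP[es sk].
  have s0 : s <= 0 by lra.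
  have Ss : S s by apply: eS; rewrite /= ltr_distlC -KE; lra.
  have us0 : u s = 0.
    apply/eqP; rewrite eq_le us// andbT leNgt; apply/negP => /(us_mu Ss).
    rewrite sum_sorted_flow// -KE (_ : _ && _ = false).
      by rewrite mulr0; move: mu0; lra.
    by apply/negP => /andP[]; lra.
  rewrite hE// /decr ext0_ord !ext0_ge//.
  by have := (cs Ss k).1; rewrite us0 mul0r; lra.
have hN : continuous (fun s => - h s) by move=> s; apply: cvgN; exact: hc.
have h_le : h (- a k.+1) <= decr v k.
  by apply: (ae_le_itv_cvg hc _ _ above); lra.
have h_ge : - h (- a k.+1) <= - decr v k.
  by apply: (ae_le_itv_cvg hN pa _ below); lra.
by move: h_le h_ge; rewrite /h opprK; lra.
Qed.

End PeakEquilibrium.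

(** * Transfer to all optimal flows and the balance equations *)

Lemma Rintegral_ae_eq (R : realType) (S D : set R) (f g : R -> R) :
    measurable D -> D `<=` S -> measurable S ->
    measurable_fun S f -> measurable_fun S g ->
    {ae @lebesgue_measure R, forall s, S s -> f s = g s} ->
  \int[@lebesgue_measure R]_(s in D) f s =
  \int[@lebesgue_measure R]_(s in D) g s.
Proof.
move=> mD DS mS mf mg fg; rewrite /Rintegral; congr fine.
apply: ae_eq_integral => //.
- by apply: measurable_EFin_fun; exact: measurable_funS mf.
- by apply: measurable_EFin_fun; exact: measurable_funS mg.
by apply: filterS fg => s fgs /DS Ss; rewrite fgs.
Qed.

Theorem proposition6p5 (R : realType) (K : nat) (beta gamma : 'I_K -> R)
  (fe fl : R -> R) (mu : R) (Q : 'I_K -> R) (S : set R)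
  (K_gt0 : (0 < K)%N)
  (beta_gt0 : forall k, 0 < beta k)
  (beta_decr : forall i j : 'I_K, (i < j)%N -> beta j < beta i)
  (gamma_gt0 : forall k, 0 < gamma k)
  (gamma_decr : forall i j : 'I_K, (i < j)%N -> gamma j < gamma i)
  (fe_cont : {within [set s : R | s <= 0], continuous fe})
  (fe_decr : forall s t : R, s < t -> t <= 0 -> fe t < fe s)
  (fe0 : fe 0 = 0)
  (fl_cont : {within [set s : R | 0 <= s], continuous fl})
  (fl_incr : forall s t : R, 0 <= s -> s < t -> fl s < fl t)
  (fl0 : fl 0 = 0)
  (mu_gt0 : 0 < mu)
  (Q_gt0 : forall k, 0 < Q k)
  (S_itv : is_interval S)
  (S_long : `[- ((\sum_(k < K) Q k) / mu), (\sum_(k < K) Q k) / mu]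
              `<=` interior S) :
  let c := cost beta gamma fe fl in
  [/\ (exists x, optimal c mu Q S x),
      (forall x y, optimal c mu Q S x -> optimal c mu Q S y ->
         {ae @lebesgue_measure R, forall s, S s -> forall k, x k s = y k s})
    & (forall x, optimal c mu Q S x <-> exists u v, equilibrium c mu Q S x u v)]
  /\
  forall x, optimal c mu Q S x ->
  let se := s_early mu S x in
  let sl := s_late mu S x in
  [/\ {ae @lebesgue_measure R, forall s, S s -> forall k : 'I_K,
         s \notin `[- se k.+1, - se k] -> s \notin `[sl k, sl k.+1] ->
         x k s = 0},
      se 0%N = 0 /\ sl 0%N = 0
    & forall k : 'I_K, - se k.+1 <= - se k /\ sl k <= sl k.+1]
  /\
  ((forall k : 'I_K, - se k.+1 < - se k /\ sl k < sl k.+1) ->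
   forall k : 'I_K,
   [/\ sl k.+1 + se k.+1 = (\sum_(j < K | (j <= k)%N) Q j) / mu,
       drop_next beta k * fe (- se k.+1) = drop_next gamma k * fl (sl k.+1),
       (forall u v, equilibrium c mu Q S x u v ->
          drop_next beta k * fe (- se k.+1) = drop_next v k)
     & (forall a b : R, 0 <= a -> 0 <= b ->
          b + a = (\sum_(j < K | (j <= k)%N) Q j) / mu ->
          drop_next beta k * fe (- a) = drop_next gamma k * fl b ->
          a = se k.+1 /\ b = sl k.+1)]).
Proof.
(* Clamping makes both functions continuous and monotone on the whole line without changing the
   costs, which evaluate [fe] and [fl] only on their half-lines. *)
pose phie t := fe (- Num.max 0 t); pose phil t := fl (Num.max 0 t).
have phieE t : 0 <= t -> phie t = fe (- t).
  by move=> t0; rewrite /phie (max_idPr t0).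
have philE t : 0 <= t -> phil t = fl t.
  by move=> t0; rewrite /phil (max_idPr t0).
have max0_nd (s t : R) : s <= t -> Num.max 0 s <= Num.max 0 t.
  by move=> st; rewrite le_max2.
have max0_cont : continuous (fun t : R => Num.max 0 t).
  move=> t; apply: (@continuous_max R R (cst 0) id); last exact: cvg_id.
  exact: cst_continuous.
have max0_ge0 (t : R) : 0 <= Num.max 0 t by rewrite le_max lexx.
have phie_cont : continuous phie.
  apply: (continuous_comp_within fe_cont (g := fun t => - Num.max 0 t)).
    by move=> t; apply: cvgN; exact: max0_cont.
  by move=> t /=; rewrite oppr_le0.
have phil_cont : continuous phil.
  exact: (continuous_comp_within fl_cont max0_cont max0_ge0).
have phie_nd : {homo phie : s t / s <= t}.
  move=> s t /max0_nd; rewrite le_eqVlt => /predU1P[st|st].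
    by rewrite /phie st.
  by apply/ltW/fe_decr; rewrite ?ltrN2 ?oppr_le0.
have phil_nd : {homo phil : s t / s <= t}.
  move=> s t /max0_nd; rewrite le_eqVlt => /predU1P[st|st].
    by rewrite /phil st.
  exact/ltW/fl_incr.
have phie_lt s t : 0 <= s -> s < t -> phie s < phie t.
  move=> s0 st; rewrite !phieE ?(le_trans s0 (ltW st))//.
  by apply: fe_decr; rewrite ?ltrN2 ?oppr_le0.
have phil_lt s t : 0 <= s -> s < t -> phil s < phil t.
  by move=> s0 st; rewrite !philE ?(le_trans s0 (ltW st))// fl_incr.
have phie0 : phie 0 = 0 by rewrite phieE// oppr0.
have phil0 : phil 0 = 0 by rewrite philE.
move=> c.
have cE : c = cost beta gamma (fun s => phie (- s)) phil.
  apply/funext => k; apply/funext => s; rewrite /c /cost.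
  have [s0|s0] := leP s 0; first by rewrite phieE ?opprK// oppr_ge0.
  by rewrite philE// ltW.
rewrite cE; clear c cE; set c := cost _ _ _ _.
have mS : measurable S by exact: is_interval_measurable.
have mc k : measurable_fun S (c k) by exact: measurable_cost.
have c_ge0 k s : 0 <= c k s by exact: cost_ge0.
have [a [b [a0 b0 abL ab_nd]]] := sorted_bounds_exist phie_cont phil_cont
  phie_nd phil_nd beta_gt0 gamma_gt0 beta_decr gamma_decr mu_gt0 Q_gt0.
have a_nd i : (i < K)%N -> a i <= a i.+1 by move=> /ab_nd[].
have b_nd i : (i < K)%N -> b i <= b i.+1 by move=> /ab_nd[].
have aK : 0 <= a K by rewrite -[leLHS]a0 (cell_bounds_le a_nd).
have bK : 0 <= b K by rewrite -[leLHS]b0 (cell_bounds_le b_nd).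
(* [a K] and [b K] are nonnegative with sum [Q / mu] for the total demand, so each is at most that
   length. *)
have abS' : `[- a K, b K] `<=` interior S.
  have := abL K; under eq_bigl => k do rewrite ltn_ord.
  move=> abK; apply: subset_trans S_long => s /=; rewrite !in_itv/= -abK; lra.
have abS : `[- a K, b K] `<=` S by exact: subset_trans (@interior_subset _ _).
have abQ (k : 'I_K) : mu * ((a k.+1 - a k) + (b k.+1 - b k)) = Q k.
  have := abL k.+1; have := abL k.
  rewrite !sum_ord_ext0 big_nat_recr//= ext0_ord mulrDl => <- abk.
  have -> : (a k.+1 - a k) + (b k.+1 - b k) = Q k / mu by lra.
  by rewrite mulrC divfK// gt_eqF.
pose x0 := sorted_flow (K := K) mu a b.
pose u0 := sorted_rent beta gamma phie phil a b.
(* The minimum respects both price bounds, and by the first-order conditions it is attained on each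
   side where the group has a nonempty cell. *)
pose v0 (k : 'I_K) :=
  Num.min (early_price beta phie a k) (late_price gamma phil b k).
have eq0 : equilibrium c mu Q S x0 u0 v0.
  apply: sorted_equilibrium => // k.
  - by rewrite /v0 !ge_min !lexx orbT.
  - move=> akk; rewrite /v0 (min_idPl _)//.
    by have [_ _ /(_ akk)] := ab_nd _ (ltn_ord k).
  - move=> bkk; rewrite /v0 (min_idPr _)//.
    by have [_ _ _ /(_ bkk)] := ab_nd _ (ltn_ord k).
have decr_neq (w : 'I_K -> R) : (forall i j : 'I_K, (i < j)%N -> w j < w i) ->
    forall i j, i != j -> w i - w j != 0.
  move=> w_decr i j; rewrite subr_eq0 neq_ltn => /orP[] /w_decr.
    by move=> wij; rewrite gt_eqF.
  by move=> wij; rewrite lt_eqF.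
have c_neq v : {ae @lebesgue_measure R, forall s, S s ->
    forall k : 'I_K, c k s != v k}.
  have : {ae @lebesgue_measure R, forall s, forall k : 'I_K, c k s != v k}.
    apply: filter_forall => k.
    by apply: cost_ae_neq; rewrite ?gt_eqF.
  by apply: filterS => s cs _.
have cB_neq v : {ae @lebesgue_measure R, forall s, S s ->
    forall j k : 'I_K, j != k -> c j s - c k s != v j - v k}.
  have : {ae @lebesgue_measure R, forall s, forall j k : 'I_K, j != k ->
      c j s - c k s != v j - v k}.
    apply: filter_forall => j; apply: filter_forall => k.
    have [->|jk] := eqVneq j k; first exact: filterE.
    (* The difference of two costs is itself a cost, with coefficients nonzero by strict
       monotonicity. *)
    have := @cost_ae_neq R K (fun=> beta j - beta k) (fun=> gamma j - gamma k)
      phie phil phie_lt phil_lt k (v j - v k)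
      (decr_neq _ beta_decr _ _ jk) (decr_neq _ gamma_decr _ _ jk).
    apply: filterS => s + _; rewrite /c /cost.
    by case: ifP => _; rewrite mulrBl.
  by apply: filterS => s cs _.
have opt_eq x : optimal c mu Q S x -> equilibrium c mu Q S x u0 v0.
  exact: (optimal_equilibrium mS mc c_ge0 Q_gt0 eq0).
have eq_opt x u v : equilibrium c mu Q S x u v -> optimal c mu Q S x.
  exact: (equilibrium_optimal mS mc c_ge0 Q_gt0).
have opt_ae x y : optimal c mu Q S x -> optimal c mu Q S y ->
    {ae @lebesgue_measure R, forall s, S s -> forall k, x k s = y k s}.
  move=> /opt_eq eqx /opt_eq eqy.
  exact: (equilibrium_flow_unique (c_neq v0) (cB_neq v0) eqx eqy).
have opt0 := eq_opt _ _ _ eq0.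
split.
  split => //; first by exists x0.
  by move=> x; split=> [/opt_eq eqx|[u [v /eq_opt]]//]; exists u0, v0.
move=> x optx se sl; have x_x0 := opt_ae _ _ optx opt0.
have [[mx _ _ _] _] := optx.
have mx0 k : measurable_fun S (x0 k) by exact: measurable_sorted_flow.
(* The amounts of [x] agree with those of [x0], which recover the bounds used to build it. *)
have seE n : (n <= K)%N -> se n = a n.
  apply: cumulative_amount => //; first by rewrite gt_eqF.
  move=> k; rewrite -(early_amount_sorted_flow mu_gt0 a0 b0 a_nd b_nd k mS abS).
  apply: (Rintegral_ae_eq _ _ mS (mx k) (mx0 k)).
  - by apply: measurableI => //; rewrite -set_itvNyc; exact: measurable_itv.
  - exact: subIsetl.
  - by apply: filterS x_x0 => s xs Ss; exact: xs.
have slE n : (n <= K)%N -> sl n = b n.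
  apply: cumulative_amount => //; first by rewrite gt_eqF.
  move=> k; rewrite -(late_amount_sorted_flow mu_gt0 a0 b0 a_nd b_nd k mS abS).
  apply: (Rintegral_ae_eq _ _ mS (mx k) (mx0 k)).
  - by apply: measurableI => //; rewrite -set_itvoy; exact: measurable_itv.
  - exact: subIsetl.
  - by apply: filterS x_x0 => s xs Ss; exact: xs.
split.
  split.
  - apply: filterS x_x0 => s xs Ss k; rewrite xs//.
    rewrite !seE ?slE ?(ltnW (ltn_ord k))// !in_itv/= => not_early not_late.
    rewrite /x0 /sorted_flow !indicE !mem_setE !in_itv/=.
    rewrite (_ : (- a k.+1 < s <= - a k)%R = false); last first.
      by apply: contraNF not_early => /andP[/ltW -> ->].
    rewrite (_ : (b k < s <= b k.+1)%R = false) ?addr0 ?mulr0//.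
    by apply: contraNF not_late => /andP[/ltW -> ->].
  - by rewrite seE ?slE.
  - move=> k; rewrite !seE ?slE ?(ltnW (ltn_ord k))// lerN2.
    by rewrite a_nd ?b_nd.
move=> strict k.
have a_lt i : (i < K)%N -> a i < a i.+1.
  move=> iK; have [+ _] := strict (Ordinal iK).
  by rewrite ltrN2 !seE//= ltnW.
have b_lt i : (i < K)%N -> b i < b i.+1.
  move=> iK; have [_] := strict (Ordinal iK).
  by rewrite !slE//= ltnW.
(* Strictness activates both first-order inequalities; at [K] both prices are empty sums.
   Subtracting consecutive equalities then gives [balance]. *)
have price_eq i : (i <= K)%N ->
    early_price beta phie a i = late_price gamma phil b i.
  rewrite leq_eqVlt => /predU1P[->|iK].
    by rewrite /early_price /late_price !big_geq.
  have [_ _ le ge] := ab_nd _ iK.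
  by apply/eqP; rewrite eq_le le ?ge ?a_lt ?b_lt.
have kK := ltn_ord k.
have a_ge0 : 0 <= a k.+1 by rewrite -[leLHS]a0 (cell_bounds_le a_nd).
have b_ge0 : 0 <= b k.+1 by rewrite -[leLHS]b0 (cell_bounds_le b_nd).
have balance : decr beta k * phie (a k.+1) = decr gamma k * phil (b k.+1).
  have := price_eq k (ltnW kK); rewrite early_price_recl// late_price_recl//.
  by rewrite (price_eq k.+1 kK) => /addIr.
rewrite seE// slE// !drop_nextE -phieE// -philE//; split=> //.
- by rewrite addrC abL.
- move=> u v eqx; rewrite drop_nextE.
  (* Multipliers supporting [x] also support the optimal [x0], whose explicit form makes the price
     drop computable. *)
  have eq0' : equilibrium c mu Q S x0 u v.
    exact: (optimal_equilibrium mS mc c_ge0 Q_gt0 eqx opt0).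
  exact: (equilibrium_price_drop phie_cont _ mu_gt0 abS' a0 b0 a_lt b_nd eq0').
move=> a' b' a'0 b'0 ab'; rewrite -phieE// -philE// => balance'.
have ab : b k.+1 + a k.+1 = b' + a' by rewrite ab' addrC abL.
have bd := decr_gt0 beta_gt0 beta_decr kK.
have gd := decr_gt0 gamma_gt0 gamma_decr kK.
(* With the sum of both bounds fixed, a larger early bound strictly raises the early side of the
   balance and strictly lowers the late one, so only one pair can solve it. *)
suff a'E : a' = a k.+1 by split=> //; move: ab; rewrite a'E; lra.
apply/eqP; rewrite eq_le !leNgt; apply/andP; split; apply/negP => aa.
  have : decr beta k * phie (a k.+1) < decr beta k * phie a'.
    by rewrite ltr_pM2l// phie_lt.
  rewrite balance balance' ltNge ler_pM2l// ltW// phil_lt//.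
  by move: ab; lra.
have : decr beta k * phie a' < decr beta k * phie (a k.+1).
  by rewrite ltr_pM2l// phie_lt.
rewrite balance balance' ltNge ler_pM2l// ltW// phil_lt//.
by move: ab; lra.
Qed.
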